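(* Let $0<\mu\le L$, $f\in S_{\mu,L}(\mathbb{R}^d)$, $\alpha\in(0,\frac1L]$ and $\beta=\frac{1-\sqrt{\alpha\mu}}{1+\sqrt{\alpha\mu}}$. Consider the ASG iterations, for $k\ge0$, $$y_k=(1+\beta)x_k-\beta x_{k-1},\qquad x_{k+1}=y_k-\alpha\tilde\nabla f(y_k,w_k),$$ with state $\xi_k=[x_k^\top\ x_{k-1}^\top]^\top\in\mathbb{R}^{2d}$. Then for every $k\ge0$, $$\mathbb{E}[V_{P_\alpha}(\xi_{k+1})]\le(1-\sqrt{\alpha\mu})\,\mathbb{E}[V_{P_\alpha}(\xi_k)]+\frac{\sigma^2\alpha}{2}(1+\alpha L),$$ where $P_\alpha=\tilde P_\alpha\otimes I_d$ and $$\tilde P_\alpha=\begin{bmatrix}\sqrt{\frac{1}{2\alpha}}\\ \sqrt{\frac\mu2}-\sqrt{\frac1{2\alpha}}\end{bmatrix}\begin{bmatrix}\sqrt{\frac{1}{2\alpha}}& \sqrt{\frac\mu2}-\sqrt{\frac1{2\alpha}}\end{bmatrix}.$$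
   Context: $S_{\mu,L}(\mathbb{R}^d)$ is the set of continuously differentiable $f:\mathbb{R}^d\to\mathbb{R}$ with $\frac{\mu}{2}\|x-y\|^2\le f(x)-f(y)-\nabla f(y)^\top(x-y)\le\frac L2\|x-y\|^2$ for all $x,y$. $x^*$ is the unique minimizer of $f$, $f^*=f(x^* )$, $\xi^*=[{x^*}^\top\ {x^*}^\top]^\top$. For a symmetric positive semidefinite $P\in\mathbb{R}^{2d\times2d}$, $V_P(\xi)=(\xi-\xi^* )^\top P(\xi-\xi^* )+f(T\xi)-f^*$ with $T=[I_d\ \ 0_d]$ (so $T\xi_k=x_k$). $\otimes$ is the Kronecker product. Stochastic oracle with noise level $\sigma\ge0$: $\{w_k\}$ are independent random variables, $w_k$ being independent of the initial points and of $w_0,\dots,w_{k-1}$, and $\mathbb{E}[\tilde\nabla f(y_k,w_k)\mid y_k]=\nabla f(y_k)$, $\mathbb{E}[\|\tilde\nabla f(y_k,w_k)-\nabla f(y_k)\|^2\mid y_k]\le\sigma^2$. The initial points $x_0,x_{-1}$ (possibly random) have finite second moments. *)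

(* Defs.v *)
From HB Require Import structures.
From mathcomp Require Import all_boot all_order all_algebra.
From mathcomp Require Import finmap.
From mathcomp Require Import all_classical all_reals all_analysis.
From mathcomp Require Import mxtens.
Import Order.TTheory GRing.Theory Num.Theory.
Import numFieldNormedType.Exports.

Set Implicit Arguments.
Unset Strict Implicit.
Unset Printing Implicit Defensive.

Local Open Scope classical_set_scope.
Local Open Scope ring_scope.

(* Matrices (in particular the column vectors representing R^d) carry the
   Borel sigma-algebra of their topology. *)
HB.instance Definition _ (R : realType) (m n : nat) :=
  Measurable.copy 'M[R]_(m, n) (g_sigma_algebraType (@open 'M[R]_(m, n))).

Section Smooth.
Context {R : realType} {d : nat}.
Implicit Types (f : 'cV[R]_d -> R) (x y v : 'cV[R]_d).

(* The norm that the library puts on matrices is the sup norm. *)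
Definition enorm v : R := Num.sqrt (\sum_(i < d) v i ord0 ^+ 2).

Definition grad f x : 'cV[R]_d := \col_(i < d) 'D_(delta_mx i ord0) f x.

Definition C1 f : Prop :=
  (forall x, differentiable f x) /\ continuous (grad f).

Definition Smu_L (mu L : R) f : Prop :=
  C1 f /\
  forall x y,
    mu / 2 * enorm (x - y) ^+ 2
      <= f x - f y - ((grad f y)^T *m (x - y)) ord0 ord0
      <= L / 2 * enorm (x - y) ^+ 2.

Definition minimizer f x : Prop := forall z, f x <= f z.

End Smooth.

Section Lyapunov.
Context {R : realType} {d : nat}.

Definition Tproj : 'M[R]_(d, d + d) := row_mx 1%:M 0.

Definition lyapunov (f : 'cV[R]_d -> R) (xstar : 'cV[R]_d)
    (P : 'M[R]_(d + d)) (xi : 'cV[R]_(d + d)) : R :=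
  let xistar := col_mx xstar xstar in
  ((xi - xistar)^T *m P *m (xi - xistar)) ord0 ord0
    + f (Tproj *m xi) - f xstar.

Definition Ptilde (mu alpha : R) : 'M[R]_2 :=
  let u : 'cV[R]_2 :=
    \col_(i < 2) [:: Num.sqrt (1 / (2 * alpha));
                     Num.sqrt (mu / 2) - Num.sqrt (1 / (2 * alpha))]`_i in
  u *m u^T.

Lemma dim_double : (2 * d = d + d)%N.
Proof. by rewrite mul2n addnn. Qed.

(* [tensmx] is the Kronecker product; the cast only identifies the index
   types 'I_(2 * d) and 'I_(d + d) along the equality of their cardinals. *)
Definition Palpha (mu alpha : R) : 'M[R]_(d + d) :=
  castmx (dim_double, dim_double) (tensmx (Ptilde mu alpha) (1%:M : 'M[R]_d)).

End Lyapunov.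

Section ASG.
Context {R : realType} {d : nat} {W : Type}.
Context (g : 'cV[R]_d -> W -> 'cV[R]_d) (alpha beta : R).

Definition extrapolate (x xprev : 'cV[R]_d) : 'cV[R]_d :=
  (1 + beta) *: x - beta *: xprev.

(* The pair (x_k, x_{k-1}) along one noise path w, from (x_0, x_{-1}). *)
Fixpoint asg (x0 xm1 : 'cV[R]_d) (w : nat -> W) (k : nat) :
    'cV[R]_d * 'cV[R]_d :=
  if k is k'.+1 then
    let: (x, xprev) := asg x0 xm1 w k' in
    let y := extrapolate x xprev in
    (y - alpha *: g y (w k'), x)
  else (x0, xm1).

Definition asg_y x0 xm1 w k : 'cV[R]_d :=
  let: (x, xprev) := asg x0 xm1 w k in extrapolate x xprev.

Definition asg_xi x0 xm1 w k : 'cV[R]_(d + d) :=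
  let: (x, xprev) := asg x0 xm1 w k in col_mx x xprev.

End ASG.

Section Conditional.
Context {R : realType} {dO : measure_display} {Omega : measurableType dO}.
Context (P : probability Omega R).
Local Open Scope ereal_scope.

(* Z is a version of E[Y | G], for an integrable Y and a sub-sigma-algebra G. *)
Definition is_cond_exp (G : set (set Omega)) (Y Z : Omega -> R) : Prop :=
  [/\ P.-integrable setT (EFin \o Y),
      P.-integrable setT (EFin \o Z),
      forall B : set R, measurable B -> G (Z @^-1` B) &
      forall A, G A ->
        \int[P]_(o in A) (Z o)%:E = \int[P]_(o in A) (Y o)%:E].

Definition is_cond_exp_vec {d : nat} (G : set (set Omega))
    (Y Z : Omega -> 'cV[R]_d) : Prop :=
  forall i, is_cond_exp G (fun o => Y o i ord0) (fun o => Z o i ord0).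

Definition cond_exp_le (G : set (set Omega)) (Y : Omega -> R) (c : R) : Prop :=
  exists2 Z, is_cond_exp G Y Z & {ae P, forall o, (Z o <= c)%R}.

Definition independent_systems (F G : set (set Omega)) : Prop :=
  forall A B, F A -> G B -> P (A `&` B) = P A * P B.

Definition independent_sequence {dW : measure_display}
    {W : measurableType dW} (w : nat -> Omega -> W) : Prop :=
  forall (J : {fset nat}) (B : nat -> set W),
    (forall j, measurable (B j)) ->
    P (\bigcap_(j in [set` J]) w j @^-1` B j) =
      \prod_(j <- J) P (w j @^-1` B j).

(* The sigma-algebra generated by x_0, x_{-1}, w_0, ..., w_{k-1}. *)
Definition past {d : nat} {dW : measure_display} {W : measurableType dW}
    (x0 xm1 : Omega -> 'cV[R]_d) (w : nat -> Omega -> W) (k : nat) :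
    set (set Omega) :=
  <<s g_sigma_algebra_preimage x0 `|` g_sigma_algebra_preimage xm1 `|`
      \bigcup_(j in `I_k) g_sigma_algebra_preimage (w j) >>.

End Conditional.

(* Main.v *)
(* Write theta = sqrt (alpha mu) and e = g (y_k, w_k) - grad f (y_k).
   Combining the descent inequality at y_k with the strong convexity inequalities
   towards x_k (weight 1 - theta) and xstar (weight theta) gives, pointwise,
     V (xi_{k+1}) <= (1 - theta) V (xi_k) + alpha / 2 (1 + alpha L) |e|^2 + <Z, e>
   with Z a function of (x_k, x_{k-1}).  The last term has zero mean: Z is not a
   function of y_k alone, so the conditional mean given y_k does not suffice, but
   w_k is independent of (x_k, x_{k-1}), and Fubini reduces the integral to
   the mean of g (y, w_k) - grad f y for fixed y, which is 0 for almost every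
   value of y_k.  All iterates are square integrable because
   |grad f y|^2 <= 2 L (f y - f xstar) <= L^2 |y - xstar|^2. *)
Require Import Defs.
From mathcomp Require Import all_boot all_order all_algebra.
From mathcomp Require Import all_classical all_reals all_analysis.
From mathcomp Require Import mxtens ring lra measurable_realfun.
Import Order.TTheory GRing.Theory Num.Theory.
Import numFieldNormedType.Exports.

Local Open Scope classical_set_scope.
Local Open Scope ring_scope.

Set Implicit Arguments.
Unset Strict Implicit.

(** * The Lyapunov function in closed form *)

Lemma enorm_sqr (R : realType) (d : nat) (v : 'cV[R]_d) :
  enorm v ^+ 2 = \sum_i v i ord0 ^+ 2.
Proof. by rewrite sqr_sqrtr// sumr_ge0// => i _; rewrite sqr_ge0. Qed.

(** [Ptilde] has rank one, say [u *m u^T], and the mixed-product rule for Kronecker products moves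
    the factorization to [Palpha]: [B] is [u] tensored with the identity. *)
Lemma Palpha_factor (R : realType) (d : nat) (mu alpha : R) :
  let B := col_mx ((Num.sqrt (1 / (2 * alpha)))%:M : 'M[R]_d)
             (Num.sqrt (mu / 2) - Num.sqrt (1 / (2 * alpha)))%:M in
  Palpha mu alpha = B *m B^T.
Proof.
move=> B.
(* Under the cast, the left and right halves of the index range are the two values of the first
   Kronecker index, so the four blocks are the four entries of [Ptilde] times the identity. *)
have castl (i : 'I_d) :
    cast_ord (esym (@dim_double d)) (lshift d i) = mxtens_index (ord0 : 'I_2, i).
  by apply: val_inj.
have castr (i : 'I_d) :
    cast_ord (esym (@dim_double d)) (rshift d i) = mxtens_index (lift ord0 ord0 : 'I_2, i).
  by apply: val_inj; rewrite /= /bump/= mul1n.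
apply/matrixP => i j; rewrite castmxE /B tr_col_mx mul_col_row.
rewrite -(fintype.splitK i) -(fintype.splitK j).
case: (fintype.split i) => i'; case: (fintype.split j) => j' /=.
all: rewrite ?(block_mxEul, block_mxEur, block_mxEdl, block_mxEdr) !tr_scalar_mx.
all: by rewrite -scalar_mxM ?castl ?castr tensmxE !mxE big_ord1 !mxE/= mulr_natr.
Qed.

(** By the factorization the quadratic form is the squared norm of [B^T *m v]. Since [sqrt (mu / 2)
    = sqrt (alpha * mu) * sqrt (1 / (2 * alpha))], a common scalar comes out of both blocks. *)
Lemma lyapunov_col_mx (R : realType) (d : nat) (mu alpha : R)
    (f : 'cV[R]_d -> R) (xs x p : 'cV[R]_d) :
  0 <= mu -> 0 < alpha ->
  lyapunov f xs (Palpha mu alpha) (col_mx x p) =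
  1 / (2 * alpha) * enorm (x - xs - (1 - Num.sqrt (alpha * mu)) *: (p - xs)) ^+ 2
  + f x - f xs.
Proof.
move=> mu0 a0.
rewrite /lyapunov mul_row_col mul1mx mul0mx addr0; congr (_ + _ - _).
rewrite opp_col_mx add_col_mx Palpha_factor; set B := col_mx _%:M _.
set v := col_mx _ _.
have -> : v^T *m (B *m B^T) *m v = (B^T *m v)^T *m (B^T *m v).
  by rewrite trmx_mul trmxK !mulmxA.
have -> : B^T *m v = Num.sqrt (1 / (2 * alpha)) *:
    (x - xs - (1 - Num.sqrt (alpha * mu)) *: (p - xs)).
  rewrite /B /v tr_col_mx !tr_scalar_mx mul_row_col !mul_scalar_mx.
  rewrite [in RHS]scalerBr scalerA -scaleNr; congr (_ + _ *: _).
  rewrite mulrBr mulr1 -sqrtrM ?divr_ge0 ?mulr_ge0// ?ltW//.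
  by rewrite opprB; congr (Num.sqrt _ - _); field; rewrite gt_eqF.
rewrite mxE enorm_sqr mulr_sumr; apply: eq_bigr => i _.
by rewrite [in LHS]mxE [(_ *: _ : 'cV_ _) _ _]mxE -expr2 exprMn sqr_sqrtr// divr_ge0 ?mulr_ge0// ltW.
Qed.

(** * Consequences of the two quadratic bounds *)

Section SmuL.
Context (R : realType) (d : nat) (mu L : R) (f : 'cV[R]_d -> R).
Hypothesis hf : Smu_L mu L f.

Lemma Smu_L_bounds x y :
  mu / 2 * enorm (x - y) ^+ 2 <=
    f x - f y - \sum_i grad f y i ord0 * (x - y) i ord0 <= L / 2 * enorm (x - y) ^+ 2.
Proof.
have /(_ x y) := hf.2; rewrite [((grad f y)^T *m _) _ _]mxE.
by under eq_bigr do rewrite mxE.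
Qed.

(** A gradient step of length [1 / L] from [y] cannot go below [f xs], while the upper quadratic
    bound guarantees a decrease of [|grad f y|^2 / (2 L)]; this length maximizes the guaranteed
    decrease. *)
Lemma enorm_grad_sqr_le xs y : 0 < L -> minimizer f xs ->
  enorm (grad f y) ^+ 2 <= 2 * L * (f y - f xs).
Proof.
move=> L0 ms.
have /andP[_] := Smu_L_bounds (y - L^-1 *: grad f y) y.
have := ms (y - L^-1 *: grad f y).
rewrite [y - _ - y]addrAC subrr add0r !enorm_sqr.
under [X in _ - X <= _]eq_bigr do rewrite [(- (_ *: _) : 'cV_d) _ _]mxE [(_ *: _ : 'cV_d) _ _]mxE mulrN mulrCA -expr2.
under [X in _ <= _ * X]eq_bigr do rewrite [(- (_ *: _) : 'cV_d) _ _]mxE [(_ *: _ : 'cV_d) _ _]mxE sqrrN exprMn.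
rewrite sumrN -!mulr_sumr; set S := \sum_i _ => h1 h2.
have : S / (2 * L) <= f y - f xs.
  have -> : S / (2 * L) = L^-1 * S - L / 2 * (L^-1 ^+ 2 * S) by field; rewrite gt_eqF.
  lra.
by rewrite ler_pdivrMr ?mulr_gt0// mulrC.
Qed.

(** At [y = xs] the right-hand side of the gradient bound is zero, which kills every squared
    coordinate. *)
Lemma grad_minimizer xs : 0 < L -> minimizer f xs -> grad f xs = 0.
Proof.
move=> L0 ms; have := enorm_grad_sqr_le xs L0 ms.
rewrite subrr mulr0 enorm_sqr => S0; apply/matrixP => i j.
rewrite ord1 [RHS]mxE; apply/eqP; rewrite -sqrf_eq0; apply/eqP/le_anti.
rewrite sqr_ge0 andbT (le_trans _ S0)// (bigD1 i)//= lerDl.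
by rewrite sumr_ge0// => k _; rewrite sqr_ge0.
Qed.

Lemma Smu_L_gap_le xs x : 0 < L -> minimizer f xs ->
  f x - f xs <= L / 2 * enorm (x - xs) ^+ 2.
Proof.
move=> L0 ms; have /andP[_] := Smu_L_bounds x xs.
rewrite grad_minimizer// big1 ?subr0// => i _.
by rewrite mxE mul0r.
Qed.

End SmuL.

(** * The pointwise one-step inequality *)

(* The coefficients of the part of the one-step bound that is linear in the noise. *)
Definition noise_coef (R : realType) (d : nat) (L alpha theta : R)
    (G xs x y : 'cV[R]_d) (i : 'I_d) : R :=
  L * alpha ^+ 2 * G i ord0
    - (y i ord0 - (1 - theta) * x i ord0 - theta * xs i ord0).

(** The momentum coefficient is such that [x - (1 - theta) p = (1 + theta) y - x]. Hence [p] can be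
    eliminated, both Lyapunov squares become forms in [y], [x], [xs] and [gv], and all quadratic
    terms can be matched coordinate by coordinate. *)
Lemma asg_step_le (R : realType) (d : nat) (mu L alpha : R)
    (f : 'cV[R]_d -> R) (xs x p gv : 'cV[R]_d)
    (theta := Num.sqrt (alpha * mu))
    (y := extrapolate ((1 - theta) / (1 + theta)) x p)
    (V := lyapunov f xs (Palpha mu alpha)) :
  0 < mu -> mu <= L -> Smu_L mu L f -> 0 < alpha -> alpha <= 1 / L ->
  V (col_mx (y - alpha *: gv) x) <=
    (1 - theta) * V (col_mx x p)
    + alpha / 2 * (1 + alpha * L) * enorm (gv - grad f y) ^+ 2
    + \sum_i noise_coef L alpha theta (grad f y) xs x y i * (gv - grad f y) i ord0.
Proof.
move=> mu0 muL hf a0 aL.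
have L0 : 0 < L by apply: lt_le_trans muL.
have th2 : theta ^+ 2 = alpha * mu by rewrite sqr_sqrtr// mulr_ge0// ltW.
have th0 : 0 < theta by rewrite sqrtr_gt0 mulr_gt0.
have aL1 : alpha * L <= 1 by rewrite -ler_pdivlMr.
have th1 : theta <= 1.
  by rewrite -[leRHS]sqrtr1 ler_wsqrtr// (le_trans _ aL1)// ler_pM2l.
rewrite /V !lyapunov_col_mx ?(ltW mu0)// -/theta.
have /andP[_ H1] := Smu_L_bounds hf (y - alpha *: gv) y.
have /andP[H2 _] := Smu_L_bounds hf x y.
have /andP[H3 _] := Smu_L_bounds hf xs y.
set G := grad f y in H1 H2 H3 *.
rewrite !enorm_sqr in H1 H2 H3 *.
set S1 := \sum_i G i ord0 * (y - _ - y) i ord0 in H1.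
set S2 := \sum_i (y - _ - y) i ord0 ^+ 2 in H1.
set S3 := \sum_i G i ord0 * (x - y) i ord0 in H2.
set S4 := \sum_i (x - y) i ord0 ^+ 2 in H2.
set S5 := \sum_i G i ord0 * (xs - y) i ord0 in H3.
set S6 := \sum_i (xs - y) i ord0 ^+ 2 in H3.
set T1 := \sum_i _ ^+ 2; set T2 := \sum_i _ ^+ 2; set T3 := \sum_i _ ^+ 2.
set T4 := \sum_i _.
pose S7 := \sum_i (G i ord0) ^+ 2.
have S40 : 0 <= S4 by apply: sumr_ge0 => i _; exact: sqr_ge0.
have S70 : 0 <= S7 by apply: sumr_ge0 => i _; exact: sqr_ge0.
(* Strong convexity at [y] is used towards [x] with weight [1 - theta] and
   towards [xs] with weight [theta]; the slack is [S4] and [S7]. *)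
have key : 1 / (2 * alpha) * T1 + S1 + L / 2 * S2
    + (1 - theta) * (- S3 - mu / 2 * S4) + theta * (- S5 - mu / 2 * S6)
  = (1 - theta) * (1 / (2 * alpha) * T2) + alpha / 2 * (1 + alpha * L) * T3 + T4
    - theta * (1 - theta ^+ 2) / (2 * alpha) * S4 - alpha / 2 * (1 - alpha * L) * S7.
  rewrite /T1 /S1 /S2 /S3 /S4 /S5 /S6 /T2 /T3 /T4 /S7.
  do 4! rewrite ?mulr_sumr -?sumrN -?big_split/=.
  apply: eq_bigr => i _; rewrite /noise_coef /y /extrapolate !mxE.
  (* Eliminating [mu] makes the identity rational in [theta] and [alpha], with no square root left
     to simplify. *)
  have -> : mu = theta ^+ 2 / alpha by rewrite th2; field; rewrite gt_eqF.
  field.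
  by rewrite !gt_eqF//= ltr_wpDl.
(* The step size bound enters here: [alpha * mu <= alpha * L <= 1] gives both slack terms their
   sign. *)
have e1 : 0 <= theta * (1 - theta ^+ 2) / (2 * alpha) * S4.
  rewrite mulr_ge0// divr_ge0 ?mulr_ge0 ?(ltW th0) ?(ltW a0)//.
  by rewrite th2 subr_ge0 (le_trans _ aL1)// ler_pM2l.
have e2 : 0 <= alpha / 2 * (1 - alpha * L) * S7.
  by rewrite !mulr_ge0 ?subr_ge0// ltW.
have e3 : (1 - theta) * (mu / 2 * S4) <= (1 - theta) * (f x - f y - S3).
  by rewrite ler_wpM2l// subr_ge0.
have e4 : theta * (mu / 2 * S6) <= theta * (f xs - f y - S5).
  by rewrite ler_wpM2l// ltW.
lra.
Qed.

(** * Borel measurability of matrix-valued maps *)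

(** Open sets generate the sigma-algebra, and each is a countable union of boxes with rational
    centre and radius [1 / (k + 1)]. The preimage of a box is a finite intersection of preimages of
    balls under the coordinates. *)
Lemma measurable_fun_mx (R : realType) (m n : nat) (d : measure_display)
    (T : measurableType d) (h : T -> 'M[R]_(m, n)) :
  (forall i j, measurable_fun setT (fun t => h t i j)) -> measurable_fun setT h.
Proof.
move=> mh; apply: (measurability (@open 'M[R]_(m, n))) => // _ [U oU <-].
rewrite setTI.
pose box (q : 'M[rat]_(m, n) * nat) : set 'M[R]_(m, n) :=
  [set M | forall i j, `|ratr (q.1 i j) - M i j| < q.2.+1%:R^-1].
have -> : h @^-1` U = \bigcup_(q in [set q | box q `<=` U]) (h @^-1` box q).
  apply/seteqP; split=> [t Ut|t [q /= qU]]; last exact: qU.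
  have /nbhs_ballP[e /= e0 eU] : nbhs (h t) U by exact: open_nbhs_nbhs.
  (* A radius below [e / 2] ensures that a box containing [h t] lies in the ball of radius [e]
     around [h t], although its centre is another point. *)
  have [k ke] : exists k : nat, k.+1%:R^-1 < e / 2.
    exists (Num.truncn (e / 2)^-1).
    by rewrite invf_plt ?posrE ?divr_gt0// truncnS_gt.
  have /all_sig2[q1 _ q1P] : forall ij : 'I_m * 'I_n, {q : rat | True &
      `|ratr q - h t ij.1 ij.2| < k.+1%:R^-1}.
    move=> ij; apply: cid2.
    have k0 : 0 < (k.+1%:R^-1 : R) by rewrite invr_gt0.
    set r := k.+1%:R^-1 in k0 *; set a := h t _ _.
    have : a - r < a + r by lra.
    move=> /rat_in_itvoo[q]; rewrite in_itv/= => /andP[q1 q2]; exists q => //; rewrite ltr_norml; apply/andP; split; lra.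
  exists (\matrix_(i, j) q1 (i, j), k) => /=; last first.
    by move=> i j; rewrite mxE; exact: (q1P (i, j)).
  move=> M boxM; apply: eU; split=> // i j.
  have := boxM i j; rewrite mxE /= => h1; rewrite /ball/=.
  have /= h2 := q1P (i, j).
  rewrite (_ : h t i j - M i j = (ratr (q1 (i, j)) - M i j) - (ratr (q1 (i, j)) - h t i j)); last by ring.
  rewrite (le_lt_trans (ler_normB _ _))// [e]splitr (lt_trans (ltrD h1 h2))//.
  by rewrite ltrD.
rewrite bigcup_mkcond; apply: countable_bigcupT_measurable => // q.
case: ifPn => // _.
have -> : h @^-1` box q = \bigcap_(i in [set: 'I_m]) \bigcap_(j in [set: 'I_n])
    ((fun t => h t i j) @^-1` ball (ratr (q.1 i j) : R) (q.2.+1%:R^-1)).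
  by apply/seteqP; split=> t /= H i; [move=> _ j _; exact: H|move=> j; exact: H].
apply: fin_bigcap_measurable => // i _; apply: fin_bigcap_measurable => // j _.
by rewrite -[X in measurable X]setTI; apply: mh => //; exact: measurable_ball.
Qed.

Lemma continuous_mx_measurable (R : realType) (m n : nat) (h : 'M[R]_(m, n) -> R) :
  continuous h -> measurable_fun setT h.
Proof.
move=> /continuousP ch; apply: (measurability _ (RGenOpens.measurableE R)) => //.
move=> _ [_ [a [b ->] <-]]; rewrite setTI; apply: sub_sigma_algebra.
by apply: ch; exact: interval_open.
Qed.

Lemma measurable_mx_coord (R : realType) (m n : nat) (d : measure_display)
    (T : measurableType d) (h : T -> 'M[R]_(m, n)) i j :
  measurable_fun setT h -> measurable_fun setT (fun t => h t i j).
Proof.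
move=> mh; apply: (@measurableT_comp _ _ _ _ _ _ (fun M : 'M[R]_(m, n) => M i j)) => //.
by apply: continuous_mx_measurable; exact: coord_continuous.
Qed.

(** * Measurability of the iterates *)

Section asg_measurability.
Context (R : realType) (d : nat) (dW : measure_display) (W : measurableType dW).
Context (g : 'cV[R]_d -> W -> 'cV[R]_d) (alpha beta : R).
Hypothesis mg : measurable_fun setT (fun p : 'cV[R]_d * W => g p.1 p.2).
Context (dO : measure_display) (T : measurableType dO).
Context (x0 xm1 : T -> 'cV[R]_d) (w : nat -> T -> W).
Hypotheses (mx0 : measurable_fun setT x0) (mxm1 : measurable_fun setT xm1).

Lemma measurable_extrapolate (x p : T -> 'cV[R]_d) :
  measurable_fun setT x -> measurable_fun setT p ->
  measurable_fun setT (fun t => extrapolate beta (x t) (p t)).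
Proof.
move=> mx mp; apply: measurable_fun_mx => i j.
under eq_fun do rewrite !mxE.
by apply: measurable_funB; apply: measurable_funM => //; exact: measurable_mx_coord.
Qed.

(** The space [T] is arbitrary and only the noises before [k] are assumed measurable, so that the
    result can be used with the sigma-algebra of the past in place of the full one. *)
Lemma measurable_asg k :
  (forall j, (j < k)%N -> measurable_fun setT (w j)) ->
  measurable_fun setT (fun t => (asg g alpha beta (x0 t) (xm1 t) (w ^~ t) k).1) /\
  measurable_fun setT (fun t => (asg g alpha beta (x0 t) (xm1 t) (w ^~ t) k).2).
Proof.
elim: k => [//|k IH] mw.
have [m1 m2] := IH (fun j jk => mw j (ltnW jk)).
pose y t := extrapolate beta (asg g alpha beta (x0 t) (xm1 t) (w ^~ t) k).1
  (asg g alpha beta (x0 t) (xm1 t) (w ^~ t) k).2.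
split; last by rewrite /=; under eq_fun do rewrite [asg _ _ _ _ _ _ _]surjective_pairing/=.
have -> : (fun t => (asg g alpha beta (x0 t) (xm1 t) (w ^~ t) k.+1).1) =
    (fun t => y t - alpha *: g (y t) (w k t)).
  by apply/funext => t /=; rewrite /y; case: asg.
have my : measurable_fun setT y := measurable_extrapolate m1 m2.
move: y my => y my; apply: measurable_fun_mx => i j; under eq_fun do rewrite !mxE.
apply: measurable_funB; first exact: measurable_mx_coord.
apply: measurable_funM => //; apply: measurable_mx_coord.
apply: (@measurableT_comp _ _ _ _ _ _ (fun p : 'cV[R]_d * W => g p.1 p.2) _
  (fun t => (y t, w k t))) => //.
by apply: measurable_fun_pair => //; exact: mw.
Qed.

End asg_measurability.

(** * Independence, product laws and Fubini *)

Section independence.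
Local Open Scope ereal_scope.
Context (R : realType) (d : measure_display) (T : measurableType d) (P : probability T R).
Context (dW : measure_display) (W : measurableType dW) (w : {mfun T >-> W}).

Definition independent_of_noise (dE : measure_display) (E : measurableType dE)
    (X : T -> E) : Prop :=
  forall A B, measurable A -> measurable B ->
    P (X @^-1` A `&` w @^-1` B) = P (X @^-1` A) * P (w @^-1` B).

(** Independence says that the joint law of [X] and [w] agrees with the product of the marginal laws
    on rectangles. Uniqueness of the product measure extends this to all measurable sets, and Fubini
    applies. *)
Lemma integral_independent (dE : measure_display) (E : measurableType dE)
    (X : {mfun T >-> E}) (F : E * W -> \bar R) :
  independent_of_noise X -> measurable_fun setT F ->
  P.-integrable setT (fun t => F (X t, w t)) ->
  (distribution P X \x distribution P w).-integrable setT F /\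
  \int[P]_t F (X t, w t) = \int[distribution P X]_x \int[distribution P w]_v F (x, v).
Proof.
move=> indep mF intF.
have mXw : measurable_fun setT (fun t => (X t, w t)) by exact: measurable_fun_pair.
pose Xw : {mfun T >-> (E * W)%type} := mfun_Sub (mem_set mXw).
have lawE A : measurable A ->
    (distribution P X \x distribution P w) A = distribution P Xw A.
  by move=> mA; apply: product_measure_unique => // B C mB mC; exact: indep.
have intF' : (distribution P X \x distribution P w).-integrable setT F.
  apply/integrableP; split=> //.
  rewrite (eq_measure_integral (distribution P Xw)); last by move=> A mA _; exact: lawE.
  rewrite ge0_integral_distribution//; last exact: measurableT_comp.
  by have /integrableP[] := intF.
split=> //; rewrite -[RHS]/(\int[_]_x fubini_F _ F x) integral12_prod_meas1//.
rewrite (eq_measure_integral (distribution P Xw)); last by move=> A mA _; exact: lawE.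
by rewrite integral_distribution.
Qed.

(* [Z] need not be a function of [X]: by independence of the pair, conditioning
   on [(Z, X)] integrates [S (X, _)] against the law of the noise alone, which
   vanishes for almost every value of [X]. *)
Lemma integral_independent_centered (dE : measure_display) (E : measurableType dE)
    (X : {mfun T >-> E}) (Z : {mfun T >-> R}) (S : E * W -> R) :
  independent_of_noise (fun t => (Z t, X t)) -> measurable_fun setT S ->
  P.-integrable setT (fun t => (S (X t, w t))%:E) ->
  P.-integrable setT (fun t => (Z t * S (X t, w t))%:E) ->
  (forall B, measurable B -> \int[P]_(t in X @^-1` B) (S (X t, w t))%:E = 0) ->
  \int[P]_t (Z t * S (X t, w t))%:E = 0.
Proof.
move=> indepZX mS intS intZS S0.
have indepX : independent_of_noise X.
  move=> A B mA mB; have := indepZX (setT `*` A) B (measurableX measurableT mA) mB.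
  have -> //: (fun t => (Z t, X t)) @^-1` (setT `*` A) = X @^-1` A.
  by apply/seteqP; split=> t //= [].
have mSE : measurable_fun setT (EFin \o S) by exact/measurable_EFinP.
have [intS' _] := integral_independent indepX mSE intS.
pose H := fubini_F (distribution P w) (EFin \o S).
have H0 : ae_eq (distribution P X) setT H (cst 0).
  apply: integral_ae_eq => //; first exact: integrable_fubini_F.
  move=> B _ mB; rewrite integral_cst// mul0e.
  have mSB : measurable_fun setT (fun p : E * W => (\1_B p.1 * S p)%:E).
    apply/measurable_EFinP/measurable_funM => //.
    by apply: (@measurableT_comp _ _ _ _ _ _ (\1_B : E -> R)).
  have SBE : (fun t => (\1_B (X t) * S (X t, w t))%:E) =
      (fun t => (S (X t, w t))%:E) \_ (X @^-1` B).
    apply/funext => t; rewrite patchE indicE.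
    have -> : (t \in X @^-1` B) = (X t \in B) by apply/idP/idP; rewrite !inE.
    by case: ifP => _; rewrite ?mul1r ?mul0r.
  have mXB : measurable (X @^-1` B) by rewrite -[X in measurable X]setTI; exact: measurable_funP.
  have intSB : P.-integrable setT (fun t => (\1_B (X t) * S (X t, w t))%:E).
    by rewrite SBE; move/(integrable_mkcond _ mXB): (integrableS measurableT mXB (@subsetT _ _) intS).
  have [_] := integral_independent indepX mSB intSB.
  rewrite /= SBE -integral_mkcond S0// => ->.
  rewrite [in LHS]integral_mkcond; apply: eq_integral => x _ /=.
  rewrite patchE indicE; case: ifP => _.
    by apply: eq_integral => v _; rewrite mul1r.
  by rewrite integral0_eq// => v _; rewrite mul0r.
have mZX : measurable_fun setT (fun t => (Z t, X t)) by exact: measurable_fun_pair.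
pose ZX : {mfun T >-> (R * E)%type} := mfun_Sub (mem_set mZX).
pose F (p : R * E * W) : \bar R := (p.1.1 * S (p.1.2, p.2))%:E.
have mF : measurable_fun setT F.
  apply/measurable_EFinP/measurable_funM.
    exact: (measurableT_comp measurable_fst measurable_fst).
  apply: (@measurableT_comp _ _ _ _ _ _ S) => //; apply: measurable_fun_pair => //.
  exact: (measurableT_comp measurable_snd measurable_fst).
have [intF' ->] := @integral_independent _ _ ZX F indepZX mF intZS.
rewrite -[LHS]/(\int[_]_x fubini_F _ F x) -(integral0 (distribution P ZX) setT).
apply: ae_eq_integral => //.
  exact: (measurable_fubini_F intF').
(* Two null sets of values of [X] are excluded: where [H] is nonzero, and where the section
   [S (x, _)] is not integrable. Outside them the factor [z] can be pulled out of the inner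
   integral, leaving [z * H x = 0]. *)
have := ae_integrable1 intS'.
move: H0 => [N1 [mN1 PN1 sN1]] [N2 [mN2 PN2 sN2]].
exists (snd @^-1` (N1 `|` N2)); split.
- by rewrite -[X in measurable X]setTI; apply: measurable_snd => //; exact: measurableU.
- by rewrite -[LHS]/(distribution P X (N1 `|` N2)) measureU0.
move=> [z x] /= F0; apply: contrapT => /not_orP[/= xN1 xN2]; apply: F0 => _.
have Hx : H x = 0 by apply: contrapT => Hx; apply: xN1; apply: sN1 => /= /(_ I).
have Sx : (distribution P w).-integrable setT (fun v => (S (x, v))%:E).
  by apply: contrapT => Sx; apply: xN2; apply: sN2.
rewrite /fubini_F /F/=; under eq_integral do rewrite EFinM.
by rewrite integralZl// -[X in _ * X]/(H x) Hx mule0.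
Qed.

End independence.

(** * Square-integrable random vectors *)

Section square_integrable.
Context (R : realType) (dT : measure_display) (T : measurableType dT) (P : probability T R).

Lemma Lfun1_le (X Y : T -> R) : measurable_fun setT X ->
  (forall t, `|X t| <= Y t) -> Y \in Lfun P 1 -> X \in Lfun P 1.
Proof.
move=> mX XY /Lfun1_integrable intY; apply/Lfun1_integrable.
apply: le_integrable intY => //; first exact/measurable_EFinP.
by move=> t _; rewrite lee_fin (le_trans (XY t))// ler_norm.
Qed.

Lemma sqr_Lfun1_Lfun2 (X : T -> R) : measurable_fun setT X ->
  (fun t => X t ^+ 2) \in Lfun P 1 -> X \in Lfun P 2%:E.
Proof.
move=> mX /Lfun1_integrable/integrableP[_ intX].
rewrite inE; apply/andP; split; rewrite inE//= /finite_norm unlock poweR_lty//=.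
under eq_integral do rewrite powR_mulrn// -normrX.
exact: intX.
Qed.

Lemma LfunD (p : \bar R) (X Y : T -> R) : (1 <= p)%E ->
  X \in Lfun P p -> Y \in Lfun P p -> (fun t => X t + Y t) \in Lfun P p.
Proof. by move=> p1; apply: (Lfun_addr_closed P p1).2. Qed.

Lemma LfunZ (r : R) c (X : T -> R) : 1 <= r ->
  X \in Lfun P r%:E -> (fun t => c * X t) \in Lfun P r%:E.
Proof.
move=> r1 /(Lfun_scale c r1).
by under eq_fun do rewrite /= mulrC.
Qed.

Lemma Lfun_sum (I : finType) (p : \bar R) (X : I -> T -> R) : (1 <= p)%E ->
  (forall i, X i \in Lfun P p) -> (fun t => \sum_i X i t) \in Lfun P p.
Proof.
move=> p1 LX; rewrite -fct_sumE.
by elim/big_ind: _ => //; [exact: (Lfun_addr_closed P p1).1|move=> f g; exact: LfunD].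
Qed.

Lemma measurable_Lfun (p : \bar R) (X : T -> R) : X \in Lfun P p -> measurable_fun setT X.
Proof. by move=> /sub_Lfun_mfun; rewrite inE. Qed.

Lemma mul_Lfun2 (X Y : T -> R) : X \in Lfun P 2%:E -> Y \in Lfun P 2%:E ->
  (fun t => X t * Y t) \in Lfun P 1.
Proof. exact: Lfun2_mul_Lfun1. Qed.

Lemma integral_LfunZ c (X : T -> R) : X \in Lfun P 1 ->
  (\int[P]_t (c * X t)%:E = c%:E * \int[P]_t (X t)%:E)%E.
Proof.
by move=> /Lfun1_integrable intX; under eq_integral do rewrite EFinM; rewrite integralZl.
Qed.

(** Working by coordinates lets the vector space structure of scalar L2 carry over; [L2vec_sqr] and
    [L2vec_le] translate to and from integrability of the squared Euclidean norm. *)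
Definition L2vec (d : nat) (h : T -> 'cV[R]_d) : Prop :=
  forall i, (fun t => h t i ord0) \in Lfun P 2%:E.

Context (d : nat).
Implicit Types u v : T -> 'cV[R]_d.

Lemma L2vec_measurable u : L2vec u -> measurable_fun setT u.
Proof.
move=> Lu; apply: measurable_fun_mx => i j; rewrite ord1.
exact: (measurable_Lfun (Lu i)).
Qed.

Lemma L2vec_cst c : L2vec (fun=> c : 'cV[R]_d).
Proof. by move=> i; exact: Lfun_cst. Qed.

Lemma L2vecD u v : L2vec u -> L2vec v -> L2vec (fun t => u t + v t).
Proof.
move=> Lu Lv i; under eq_fun do rewrite mxE.
by apply: LfunD => //; rewrite lee1n.
Qed.

Lemma L2vecZ a u : L2vec u -> L2vec (fun t => a *: u t).
Proof.
move=> Lu i; under eq_fun do rewrite mxE.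
by apply: LfunZ => //; rewrite ler1n.
Qed.

Lemma L2vecB u v : L2vec u -> L2vec v -> L2vec (fun t => u t - v t).
Proof.
move=> Lu /(L2vecZ (-1)) Lv.
by under eq_fun do rewrite -scaleN1r; exact: L2vecD.
Qed.

Lemma L2vec_sqr u : L2vec u -> (fun t => enorm (u t) ^+ 2) \in Lfun P 1.
Proof.
move=> Lu; under eq_fun do rewrite enorm_sqr.
apply: (Lfun_sum (X := fun i t => u t i ord0 ^+ 2)) => // i.
by under eq_fun do rewrite expr2; exact: mul_Lfun2.
Qed.

Lemma L2vec_le u (Y : T -> R) : measurable_fun setT u ->
  (forall t, enorm (u t) ^+ 2 <= Y t) -> Y \in Lfun P 1 -> L2vec u.
Proof.
move=> mu uY LY i; have mui := measurable_mx_coord i ord0 mu.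
apply: sqr_Lfun1_Lfun2 => //.
apply: (Lfun1_le _ _ LY) => [|t]; first exact: measurable_funX.
rewrite ger0_norm ?sqr_ge0// (le_trans _ (uY t))// enorm_sqr (bigD1 i)//= lerDl.
by rewrite sumr_ge0// => j _; rewrite sqr_ge0.
Qed.

End square_integrable.

(** * Moments of the iterates and of the gradient noise *)

Section asg_expectation.
Context (R : realType) (d : nat) (dO : measure_display) (Omega : measurableType dO)
  (P : probability Omega R) (dW : measure_display) (W : measurableType dW).
Context (mu L alpha beta sigma : R) (f : 'cV[R]_d -> R) (xstar : 'cV[R]_d)
  (g : 'cV[R]_d -> W -> 'cV[R]_d)
  (x0 xm1 : {RV P >-> 'cV[R]_d}) (w : nat -> {RV P >-> W}).
Hypotheses (L_gt0 : 0 < L) (hf : Smu_L mu L f) (hmin : minimizer f xstar)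
  (hg : measurable_fun setT (fun p : 'cV[R]_d * W => g p.1 p.2)).

Let x k o := (asg g alpha beta (x0 o) (xm1 o) (fun j => w j o) k).1.
Let xprev k o := (asg g alpha beta (x0 o) (xm1 o) (fun j => w j o) k).2.
Let y k o := asg_y g alpha beta (x0 o) (xm1 o) (fun j => w j o) k.
Let G k o := grad f (y k o).
Let e k o := g (y k o) (w k o) - G k o.

Hypothesis hwpast : forall k,
  independent_systems P (g_sigma_algebra_preimage (w k)) (past x0 xm1 w k).
Hypothesis hmean : forall k, is_cond_exp_vec P (g_sigma_algebra_preimage (y k))
  (fun o => g (y k o) (w k o)) (G k).
Hypothesis hvar : forall k, cond_exp_le P (g_sigma_algebra_preimage (y k))
  (fun o => enorm (e k o) ^+ 2) (sigma ^+ 2).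
Hypotheses (L2x0 : L2vec P x0) (L2xm1 : L2vec P xm1).

Lemma asg_yE k : y k = fun o => extrapolate beta (x k o) (xprev k o).
Proof. by apply/funext => o; rewrite /y /asg_y /x /xprev; case: asg. Qed.

Lemma asg_xS k : x k.+1 = fun o => y k o - alpha *: g (y k o) (w k o).
Proof. by apply/funext => o; rewrite asg_yE /x /xprev /=; case: asg. Qed.

Lemma asg_xprevS k : xprev k.+1 = x k.
Proof. by apply/funext => o; rewrite /x /xprev /=; case: asg. Qed.

Lemma measurable_grad : measurable_fun setT (grad f).
Proof.
apply: measurable_fun_mx => i j; apply: continuous_mx_measurable => z.
apply: (@continuous_comp _ _ _ (grad f) (fun M : 'cV[R]_d => M i j)).
  exact: hf.1.2.
exact: coord_continuous.
Qed.

Lemma measurable_Smu_L : measurable_fun setT f.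
Proof.
by apply: continuous_mx_measurable => z; apply: differentiable_continuous; exact: hf.1.1.
Qed.

Lemma L2vec_extrapolate (u v : Omega -> 'cV[R]_d) : L2vec P u -> L2vec P v ->
  L2vec P (fun o => extrapolate beta (u o) (v o)).
Proof. by move=> Lu Lv; apply: L2vecB; exact: L2vecZ. Qed.

(** The gap lies between 0 and [L / 2] times the squared distance to [xstar], which is
    integrable. *)
Lemma gap_Lfun1 u : L2vec P u -> (fun o => f (u o) - f xstar) \in Lfun P 1.
Proof.
move=> Lu; have LY := L2vec_sqr (L2vecB Lu (L2vec_cst P xstar)).
apply: (Lfun1_le _ _ (LfunZ (L / 2) (lexx 1) LY)) => [|o].
  apply: measurable_funB => //.
  exact: (measurableT_comp measurable_Smu_L (L2vec_measurable Lu)).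
by rewrite ger0_norm ?subr_ge0 ?hmin//; exact: Smu_L_gap_le hf _ _ _ _.
Qed.

Lemma L2vec_grad u : L2vec P u -> L2vec P (fun o => grad f (u o)).
Proof.
move=> Lu; apply: L2vec_le.
- exact: (measurableT_comp measurable_grad (L2vec_measurable Lu)).
- by move=> o; exact: enorm_grad_sqr_le hf _ _ _ _.
- by apply: (LfunZ (2 * L)) => //; exact: gap_Lfun1.
Qed.

(** Integrability of the squared error is part of the variance hypothesis, and measurability of the
    oracle value is part of [hmean]. *)
Lemma L2vec_noise k : L2vec P (G k) -> L2vec P (e k).
Proof.
move=> LG; have [Z [intE _ _ _] _] := hvar k.
apply: L2vec_le (fun o => lexx _) _; last exact/Lfun1_integrable.
apply: measurable_fun_mx => i j; rewrite ord1.
under eq_fun do rewrite mxE [X in _ + X]mxE.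
apply: measurable_funB; last exact: (measurable_Lfun (LG i)).
by have [/measurable_int/measurable_EFinP] := hmean k i.
Qed.

Lemma L2vec_asg k : L2vec P (x k) /\ L2vec P (xprev k).
Proof.
elim: k => [//|k [Lx Lp]].
have Ly : L2vec P (y k).
  by rewrite asg_yE; exact: L2vec_extrapolate Lx Lp.
have LG := L2vec_grad Ly.
split; last by rewrite asg_xprevS.
(* The oracle value is split into gradient and error, each of which is already known to be square
   integrable. *)
have -> : x k.+1 = fun o => y k o - alpha *: (G k o + e k o).
  by rewrite asg_xS; apply/funext => o; rewrite [G k o + _]addrC subrK.
exact: L2vecB Ly (L2vecZ alpha (L2vecD LG (L2vec_noise LG))).
Qed.

Lemma L2vec_y k : L2vec P (y k).
Proof.
by have [Lx Lp] := L2vec_asg k; rewrite asg_yE; exact: L2vec_extrapolate Lx Lp.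
Qed.

Lemma expectation_noise_sqr_le k :
  (\int[P]_o (enorm (e k o) ^+ 2)%:E <= (sigma ^+ 2)%:E)%E.
Proof.
have [Z [_ intZ _ ZE] Zs] := hvar k.
(* The whole space is an event of [y k], so [Z] has the same mean as the squared error. *)
rewrite -ZE; last by exists setT => //; rewrite setTI preimage_setT.
have mZ : measurable_fun setT Z by apply/measurable_EFinP; exact: measurable_int intZ.
have -> : (sigma ^+ 2)%:E = (\int[P]_o (sigma ^+ 2)%:E)%E.
  by rewrite integral_cst//= probability_setT mule1.
(* [Z] is only known to be bounded above almost everywhere. Its positive part obeys the same bound,
   as [sigma ^+ 2] is nonnegative, and can be compared as a nonnegative integrand. *)
rewrite [leLHS]integralE; apply: (@le_trans _ _ (\int[P]_o ((EFin \o Z)^\+ o))%E).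
  by rewrite leeBlDr ?leeDl ?integral_ge0//; exact: (integrable_neg_fin_num _ intZ).
apply: ae_ge0_le_integral => //.
- by apply: measurable_funepos; exact/measurable_EFinP.
- by move=> o _; rewrite lee_fin sqr_ge0.
- apply: filterS Zs => o Zs _.
  by rewrite funeposE/= ge_max !lee_fin Zs sqr_ge0.
Qed.

(** The recursion up to [k] reads only the initial points and the noises before [k]. It is therefore
    measurable when [Omega] is equipped with the sigma-algebra generated by these. *)
Lemma past_measurable k (dE : measure_display) (E' : measurableType dE)
    (h : 'cV[R]_d -> 'cV[R]_d -> E') A :
  measurable_fun setT (fun p : 'cV[R]_d * 'cV[R]_d => h p.1 p.2) -> measurable A ->
  past x0 xm1 w k ((fun o => h (x k o) (xprev k o)) @^-1` A).
Proof.
move=> mh mA.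
pose Gen : set (set Omega) := g_sigma_algebra_preimage x0 `|` g_sigma_algebra_preimage xm1 `|`
      \bigcup_(j in `I_k) g_sigma_algebra_preimage (w j).
have gen_measurable (dF : measure_display) (F : measurableType dF) (u : Omega -> F) :
    g_sigma_algebra_preimage u `<=` Gen ->
    measurable_fun setT (u : g_sigma_algebraType Gen -> F).
  by move=> uG _ B mB; apply: sub_sigma_algebra; apply: uG; exists B.
have [m1 m2] : measurable_fun setT (x k : g_sigma_algebraType Gen -> _) /\
    measurable_fun setT (xprev k : g_sigma_algebraType Gen -> _).
  apply: (measurable_asg (T := g_sigma_algebraType Gen) alpha beta hg
     (x0 := x0) (xm1 := xm1) (w := fun j o => w j o)).
  - by apply: gen_measurable => B; left; left.
  - by apply: gen_measurable => B; left; right.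
  - by move=> j jk; apply: gen_measurable => B ?; right; exists j.
have mp : measurable_fun setT (fun o : g_sigma_algebraType Gen => (x k o, xprev k o)).
  exact: measurable_fun_pair.
have := measurableT_comp mh mp.
by move=> /(_ measurableT _ mA); rewrite setTI.
Qed.

(** This is [integral_independent_centered] with [X] the point [y k] and [Z] the weight. The pair
    [(Z, X)] is determined by the past, hence independent of [w k]; the conditional mean is used
    only on events of [y k]. *)
Lemma noise_orthogonal (h : 'cV[R]_d -> 'cV[R]_d -> R) k i :
  measurable_fun setT (fun p : 'cV[R]_d * 'cV[R]_d => h p.1 p.2) ->
  (fun o => h (x k o) (xprev k o)) \in Lfun P 2%:E ->
  (\int[P]_o (h (x k o) (xprev k o) * e k o i ord0)%:E = 0)%E.
Proof.
move=> mh Lh.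
have mEh : measurable_fun setT
    (fun p : 'cV[R]_d * 'cV[R]_d => (h p.1 p.2, extrapolate beta p.1 p.2)).
  by apply: measurable_fun_pair => //; exact: measurable_extrapolate.
have my := L2vec_measurable (L2vec_y k).
pose Y : {mfun Omega >-> 'cV[R]_d} := mfun_Sub (mem_set my).
pose Z : {mfun Omega >-> R} := mfun_Sub (mem_set (measurable_Lfun Lh)).
pose S (p : 'cV[R]_d * W) : R := g p.1 p.2 i ord0 - grad f p.1 i ord0.
have eE o : e k o i ord0 = S (Y o, w k o) by rewrite /e mxE [X in _ + X]mxE.
have Le := L2vec_noise (L2vec_grad (L2vec_y k)).
under eq_integral do rewrite eE.
apply: (@integral_independent_centered _ _ _ P _ _ (w k) _ _ Y Z S).
- move=> A B mA mB; rewrite setIC muleC; apply: hwpast.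
    by exists B => //; rewrite setTI.
  have := @past_measurable k _ _ (fun a b => (h a b, extrapolate beta a b)) A mEh mA.
  by rewrite /Y /= asg_yE.
- apply: measurable_funB; first exact: (measurable_mx_coord i ord0 hg).
  exact: (measurable_mx_coord i ord0 (measurableT_comp measurable_grad measurable_fst)).
- apply/Lfun1_integrable; under eq_fun do rewrite -eE.
  by apply: (Lfun_subset12 _ (Le i)); exact: fin_num_measure.
- by apply/Lfun1_integrable; under eq_fun do rewrite -eE; exact: mul_Lfun2.
- move=> B mB; have [intg intG _ gG] := hmean k i.
  have mYB : measurable (Y @^-1` B) by rewrite -[X in measurable X]setTI; exact: measurable_funP.
  rewrite integralB_EFin//; [|exact: (integrableS measurableT mYB (@subsetT _ _))..].
  rewrite -[X in (_ - X)%E]/(\int[P]_(o in Y @^-1` B) (G k o i ord0)%:E)%E gG; last first.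
    by exists B => //; rewrite setTI.
  (* The two equal integrals cancel because they are finite. *)
  apply: subee; apply: integrable_fin_num => //.
  exact: (integrableS measurableT mYB (@subsetT _ _)).
Qed.

End asg_expectation.

(** As coordinates of a linear combination of vectors, the coefficients inherit square integrability
    from the iterates and the gradient. *)
Lemma noise_coefE (R : realType) (d : nat) (L alpha theta : R)
    (G xs x y : 'cV[R]_d) (i : 'I_d) :
  noise_coef L alpha theta G xs x y i =
  ((L * alpha ^+ 2) *: G - (y - (1 - theta) *: x - theta *: xs)) i ord0.
Proof. by rewrite !mxE. Qed.

(** * The decrease in expectation *)

Section asg_step.
Context (R : realType) (d : nat) (dO : measure_display) (Omega : measurableType dO)
  (P : probability Omega R) (dW : measure_display) (W : measurableType dW).
Context (mu L alpha sigma : R) (f : 'cV[R]_d -> R) (xstar : 'cV[R]_d)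
  (g : 'cV[R]_d -> W -> 'cV[R]_d)
  (x0 xm1 : {RV P >-> 'cV[R]_d}) (w : nat -> {RV P >-> W}).
Hypotheses (mu_gt0 : 0 < mu) (muL : mu <= L) (hf : Smu_L mu L f)
  (hmin : minimizer f xstar) (alpha_gt0 : 0 < alpha) (alphaL : alpha <= 1 / L)
  (hg : measurable_fun setT (fun p : 'cV[R]_d * W => g p.1 p.2)).

Let theta := Num.sqrt (alpha * mu).
Let beta := (1 - theta) / (1 + theta).
Let x k o := (asg g alpha beta (x0 o) (xm1 o) (fun j => w j o) k).1.
Let xprev k o := (asg g alpha beta (x0 o) (xm1 o) (fun j => w j o) k).2.
Let y k o := asg_y g alpha beta (x0 o) (xm1 o) (fun j => w j o) k.
Let xi k o := asg_xi g alpha beta (x0 o) (xm1 o) (fun j => w j o) k.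
Let V := lyapunov f xstar (Palpha mu alpha).

Hypothesis hwpast : forall k,
  independent_systems P (g_sigma_algebra_preimage (w k)) (past x0 xm1 w k).
Hypothesis hmean : forall k, is_cond_exp_vec P (g_sigma_algebra_preimage (y k))
  (fun o => g (y k o) (w k o)) (fun o => grad f (y k o)).
Hypothesis hvar : forall k, cond_exp_le P (g_sigma_algebra_preimage (y k))
  (fun o => enorm (g (y k o) (w k o) - grad f (y k o)) ^+ 2) (sigma ^+ 2).
Hypotheses (L2x0 : L2vec P x0) (L2xm1 : L2vec P xm1).

Lemma asg_xiE k : xi k = fun o => col_mx (x k o) (xprev k o).
Proof. by apply/funext => o; rewrite /xi /asg_xi /x /xprev; case: asg. Qed.

Let L_gt0 : 0 < L. Proof. exact: lt_le_trans muL. Qed.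

Lemma lyapunov_Lfun1 (u v : Omega -> 'cV[R]_d) : L2vec P u -> L2vec P v ->
  (fun o => V (col_mx (u o) (v o))) \in Lfun P 1.
Proof.
move=> Lu Lv.
under eq_fun do rewrite /V lyapunov_col_mx ?(ltW mu_gt0)// -addrA.
have Lc := L2vec_cst P xstar.
apply: LfunD => //; last exact: gap_Lfun1 L_gt0 hf hmin _ Lu.
apply: LfunZ => //; apply: L2vec_sqr; apply: L2vecB; first exact: L2vecB.
by apply: L2vecZ; exact: L2vecB.
Qed.

Lemma asg_expected_decrease k :
  (\int[P]_o (V (xi k.+1 o))%:E <=
    (1 - theta)%:E * \int[P]_o (V (xi k o))%:E
    + (sigma ^+ 2 * alpha / 2 * (1 + alpha * L))%:E)%E.
Proof.
have [Lx Lp] := L2vec_asg L_gt0 hf hmin hmean hvar L2x0 L2xm1 k.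
have [Lx' Lp'] := L2vec_asg L_gt0 hf hmin hmean hvar L2x0 L2xm1 k.+1.
have Ly := L2vec_y L_gt0 hf hmin hmean hvar L2x0 L2xm1 k.
have LG := L2vec_grad L_gt0 hf hmin Ly.
have Le := L2vec_noise hmean hvar LG.
pose e o := g (y k o) (w k o) - grad f (y k o).
(* The coefficients are expressed through the last two iterates alone, with [y] recomputed from
   them, which is the form that [noise_orthogonal] accepts. *)
pose h i a b := noise_coef L alpha theta (grad f (extrapolate beta a b)) xstar a
  (extrapolate beta a b) i.
pose c := alpha / 2 * (1 + alpha * L).
have c0 : 0 <= c by rewrite mulr_ge0 ?divr_ge0 ?addr_ge0 ?mulr_ge0 // ltW.
have mh i : measurable_fun setT (fun p : 'cV[R]_d * 'cV[R]_d => h i p.1 p.2).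
  have my : measurable_fun setT (fun p : 'cV[R]_d * 'cV[R]_d => extrapolate beta p.1 p.2).
    exact: measurable_extrapolate.
  apply: measurable_funB.
    apply: measurable_funM => //.
    exact: (measurable_mx_coord i ord0 (measurableT_comp (measurable_grad hf) my)).
  apply: measurable_funB => //; apply: measurable_funB.
    exact: (measurable_mx_coord i ord0 my).
  by apply: measurable_funM => //; exact: (measurable_mx_coord i ord0 measurable_fst).
have Lh i : (fun o => h i (x k o) (xprev k o)) \in Lfun P 2%:E.
  rewrite /h; under eq_fun do rewrite noise_coefE.
  have Ly' : L2vec P (fun o => extrapolate beta (x k o) (xprev k o)).
    exact: L2vec_extrapolate.
  have LG' := L2vec_grad L_gt0 hf hmin Ly'.
  exact: (L2vecB (L2vecZ _ LG')
    (L2vecB (L2vecB Ly' (L2vecZ _ Lx)) (L2vecZ theta (L2vec_cst P xstar)))).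
have LV : (fun o => V (xi k o)) \in Lfun P 1 by rewrite asg_xiE; exact: lyapunov_Lfun1.
have LV' : (fun o => V (xi k.+1 o)) \in Lfun P 1 by rewrite asg_xiE; exact: lyapunov_Lfun1.
have Lhe i : (fun o => h i (x k o) (xprev k o) * e o i ord0) \in Lfun P 1.
  exact: mul_Lfun2 (Lh i) (Le i).
have Lbound : (fun o => (1 - theta) * V (xi k o) + c * enorm (e o) ^+ 2) \in Lfun P 1.
  by apply: LfunD => //; apply: LfunZ => //; exact: L2vec_sqr.
have Lsum := Lfun_sum (lexx 1%E) Lhe.
have step o : V (xi k.+1 o) <= (1 - theta) * V (xi k o) + c * enorm (e o) ^+ 2
    + \sum_i h i (x k o) (xprev k o) * e o i ord0.
  have := asg_step_le xstar (x k o) (xprev k o) (g (y k o) (w k o))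
    mu_gt0 muL hf alpha_gt0 alphaL.
  have /(congr1 (@^~ o))/= yE := asg_yE alpha beta g x0 xm1 w k.
  have /(congr1 (@^~ o))/= xE := asg_xS alpha beta g x0 xm1 w k.
  have /(congr1 (@^~ o))/= pE := asg_xprevS alpha beta g x0 xm1 w k.
  rewrite -/theta -/beta -[extrapolate _ _ _]yE !asg_xiE /h -[extrapolate _ _ _]yE.
  by rewrite [x k.+1 o]xE [xprev k.+1 o]pE.
apply: (@le_trans _ _ (\int[P]_o ((1 - theta) * V (xi k o) + c * enorm (e o) ^+ 2
    + \sum_i h i (x k o) (xprev k o) * e o i ord0)%:E)%E).
  apply: le_integral => //.
  - exact/Lfun1_integrable.
  - by apply/Lfun1_integrable; exact: LfunD.
  - by move=> o _; rewrite lee_fin.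
rewrite integralD_EFin//; [|exact/Lfun1_integrable..].
(* The term linear in the noise drops out one coordinate at a time. *)
have -> : (\int[P]_o (\sum_i h i (x k o) (xprev k o) * e o i ord0)%:E = 0)%E.
  under eq_integral do rewrite -sumEFin.
  rewrite integral_sum//; last by move=> i; apply/Lfun1_integrable.
  rewrite big1// => i _.
  exact: (noise_orthogonal L_gt0 hf hmin hg hwpast hmean hvar L2x0 L2xm1 i (mh i) (Lh i)).
rewrite adde0 integralD_EFin//; last 2 first.
- by apply/Lfun1_integrable; apply: LfunZ.
- by apply/Lfun1_integrable; apply: LfunZ => //; exact: L2vec_sqr.
rewrite integral_LfunZ// integral_LfunZ; last exact: L2vec_sqr.
rewrite leeD2l//.
have -> : sigma ^+ 2 * alpha / 2 * (1 + alpha * L) = c * sigma ^+ 2 by rewrite /c; ring.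
rewrite [leRHS]EFinM; apply: lee_wpmul2l; first by rewrite lee_fin.
exact: expectation_noise_sqr_le hvar k.
Qed.

End asg_step.

Unset Implicit Arguments.

Theorem theorem2p3
  (R : realType) (d : nat)
  (dO : measure_display) (Omega : measurableType dO)
  (P : probability Omega R)
  (dW : measure_display) (W : measurableType dW)
  (mu L alpha sigma : R)
  (f : 'cV[R]_d -> R) (xstar : 'cV[R]_d)
  (g : 'cV[R]_d -> W -> 'cV[R]_d)
  (x0 xm1 : {RV P >-> 'cV[R]_d}) (w : nat -> {RV P >-> W})
  (hmu : 0 < mu) (hmuL : mu <= L)
  (hf : Smu_L mu L f)
  (hxstar : unique (minimizer f) xstar)
  (halpha0 : 0 < alpha) (halphaL : alpha <= 1 / L)
  (hsigma : 0 <= sigma)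
  (hx0 : ('E_P[fun o => (enorm (x0 o) ^+ 2)%R] < +oo)%E)
  (hxm1 : ('E_P[fun o => (enorm (xm1 o) ^+ 2)%R] < +oo)%E)
  (hg : measurable_fun setT (fun p : 'cV[R]_d * W => g p.1 p.2))
  (hw : independent_sequence P w)
  (hwpast : forall k : nat,
    independent_systems P (g_sigma_algebra_preimage (w k)) (past x0 xm1 w k)) :
  let beta : R := (1 - Num.sqrt (alpha * mu)) / (1 + Num.sqrt (alpha * mu)) in
  let y (k : nat) (o : Omega) : 'cV[R]_d :=
    asg_y g alpha beta (x0 o) (xm1 o) (fun j => w j o) k in
  let xi (k : nat) (o : Omega) : 'cV[R]_(d + d) :=
    asg_xi g alpha beta (x0 o) (xm1 o) (fun j => w j o) k in
  let V : 'cV[R]_(d + d) -> R := lyapunov f xstar (Palpha mu alpha) in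
  (forall k : nat,
    is_cond_exp_vec P (g_sigma_algebra_preimage (y k))
      (fun o => g (y k o) (w k o)) (fun o => grad f (y k o))) ->
  (forall k : nat,
    cond_exp_le P (g_sigma_algebra_preimage (y k))
      (fun o => enorm (g (y k o) (w k o) - grad f (y k o)) ^+ 2)
      (sigma ^+ 2)) ->
  forall k : nat,
    ('E_P[fun o => V (xi k.+1 o)] <=
      (1 - Num.sqrt (alpha * mu))%:E * 'E_P[fun o => V (xi k o)]
      + (sigma ^+ 2 * alpha / 2 * (1 + alpha * L))%:E)%E.
Proof.

move=> beta y xi V hmean hvar k.
(* A finite second moment gives square-integrable coordinates, the squared norm itself being the
   dominating function. *)
have L2 (u : {RV P >-> 'cV[R]_d}) :
    ('E_P[fun o => (enorm (u o) ^+ 2)%R] < +oo)%E -> L2vec P u.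
  move=> hu; apply: L2vec_le (fun o => lexx _) _; first exact: measurable_funP.
  apply/Lfun1_integrable/integrableP; split.
    apply/measurable_EFinP; under eq_fun do rewrite enorm_sqr.
    apply: measurable_sum => i; apply: measurable_funX.
    by apply: measurable_mx_coord; exact: measurable_funP.
  by under eq_integral do rewrite gee0_abs ?lee_fin ?sqr_ge0//; rewrite unlock in hu.
rewrite unlock.
exact: (asg_expected_decrease hmu hmuL hf hxstar.1 halpha0 halphaL hg hwpast hmean hvar
  (L2 _ hx0) (L2 _ hxm1)).
Qed.
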